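(* Let $n \geq 3$, let $q$ be a prime power, and let $\Psi \in Aut(\overrightarrow{\Gamma_{l-i}}(M_n(F_q)))$. Then there exist an invertible matrix $P \in M_n^*(F_q)$, a field automorphism $\Upsilon$ of $F_q$ (extended entrywise to a map $\Upsilon: M_n(F_q)\to M_n(F_q)$), and a permutation $\sigma$ of $M_n(F_q)$ satisfying $[\sigma(X)] = [X]$ for every $X \in M_n(F_q)$, such that $\Psi = \varphi_{P} \cdot \Upsilon \cdot \sigma$, i.e. $\Psi(X) = \Upsilon(\sigma(X))\,P$ for all $X \in M_n(F_q)$.
   Context: $F_q$ is the finite field with $q$ elements, $M_n(F_q)$ is the ring of all $n\times n$ matrices over $F_q$, and $M_n^*(F_q)$ is the set of invertible ones. For $X \in M_n(F_q)$, $[X] = \{AX : A \in M_n(F_q)\}$ denotes the left ideal generated by $X$. The left-ideal relation graph $\overrightarrow{\Gamma_{l-i}}(M_n(F_q))$ is the directed graph with vertex set $M_n(F_q)$ and a directed edge $X \rightarrow Y$ if and only if $[X]$ is properly contained in $[Y]$. An automorphism of a directed graph is a permutation $f$ of its vertex set such that $f(u) \rightarrow f(v)$ if and only if $u \rightarrow v$; $Aut$ denotes the group of automorphisms. For $P \in M_n^*(F_q)$, $\varphi_P: M_n(F_q) \to M_n(F_q)$ is the map $\varphi_P(X) = XP$. For a field automorphism $\Upsilon$ of $F_q$ and $X = [x_{ij}]_{n\times n}$, $\Upsilon(X) = [\Upsilon(x_{ij})]_{n\times n}$. The maps $\sigma$ are those that permute arbitrarily the elements within each class of the equivalence relation $X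 \equiv Y \iff [X] = [Y]$ on $M_n(F_q)$. The product $\cdot$ of maps is composition, with the rightmost map applied first. *)

(* Defs.v *)
From mathcomp Require Import all_boot all_order all_fingroup all_algebra.

Set Implicit Arguments.
Unset Strict Implicit.
Unset Printing Implicit Defensive.

Import GRing.Theory.
Local Open Scope ring_scope.

Definition left_ideal (F : finFieldType) (n : nat) (X : 'M[F]_n) :
    {set 'M[F]_n} :=
  [set A *m X | A in [set: 'M[F]_n]].

(* A directed graph on a finite vertex type T is given by its edge relation. *)
Definition left_ideal_graph (F : finFieldType) (n : nat) : rel 'M[F]_n :=
  fun X Y => left_ideal X \proper left_ideal Y.

Definition digraph_aut (T : finType) (e : rel T) : {set {perm T}} :=
  [set f : {perm T} | [forall u, forall v, e (f u) (f v) == e u v]].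

Lemma digraph_autP (T : finType) (e : rel T) (f : {perm T}) :
  reflect (forall u v, e (f u) (f v) = e u v) (f \in digraph_aut e).
Proof.
rewrite inE; apply: (iffP forallP) => [h u v | h u].
  by move/forallP: (h u) => /(_ v) /eqP.
by apply/forallP => v; rewrite h.
Qed.

Lemma digraph_aut_group_set (T : finType) (e : rel T) :
  group_set (digraph_aut e).
Proof.
apply/group_setP; split=> [|f g /digraph_autP hf /digraph_autP hg].
  by apply/digraph_autP => u v; rewrite !perm1.
by apply/digraph_autP => u v; rewrite !permM hg hf.
Qed.

Canonical digraph_aut_group (T : finType) (e : rel T) : {group {perm T}} :=
  Group (digraph_aut_group_set e).

Definition phi (F : finFieldType) (n : nat) (P X : 'M[F]_n) : 'M[F]_n :=
  X *m P.

(* Main.v *)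
(* The edge X -> Y means that the row space of X is strictly contained in that
   of Y.  When n >= 3 a subspace is determined by its strict subspaces and
   strict superspaces, so Psi also preserves weak inclusion of row spaces, and
   the fundamental theorem of projective geometry applies.  After a change of
   basis Psi fixes the points spanned by the basis vectors and by their sum;
   since Psi maps hyperplanes to hyperplanes, the ratio of two coordinates of
   the image of a point depends only on the ratio of the same coordinates of
   the point, and this dependence is a field automorphism Upsilon, the same for
   all pairs of coordinates.  Then sigma is Psi followed by the inverse of the
   resulting semilinear map. *)

Require Import Defs.
From HB Require Import structures.
From mathcomp Require Import all_boot all_order all_fingroup all_algebra.

Set Implicit Arguments.
Unset Strict Implicit.
Unset Printing Implicit Defensive.

Import GRing.Theory.
Local Open Scope ring_scope.

(** * Maps of row vectors that fix the standard frame *)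

Lemma mul_row_delta (R : pzRingType) n (w : 'rV[R]_n) i :
  w *m (delta_mx i 0 : 'cV_n) = (w 0 i)%:M.
Proof. by rewrite -colE; apply/matrixP => a b; rewrite !ord1 !mxE eqxx. Qed.

Section FrameFixing.

Variables (F : finFieldType) (n : nat) (f : 'rV[F]_n -> 'rV[F]_n).

(** The preimage under [f] of the kernel of a functional [c] is a subspace, the row space of [Z].
    Preservation of incidence enters only in this form. *)
Hypothesis f_hyperplane : forall c : 'cV[F]_n,
  exists Z : 'M[F]_n, forall w : 'rV_n, (w <= Z)%MS = (f w *m c == 0).

Hypothesis f_basis :
  forall i, exists2 a : F, a != 0 & f (delta_mx 0 i) = a *: delta_mx 0 i.

Hypothesis f_ones : exists2 a : F, a != 0 & f (const_mx 1) = const_mx a.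

Local Notation e i := (delta_mx 0 i : 'rV[F]_n).

Lemma vanish_add (v w : 'rV_n) (c : 'cV_n) :
  f v *m c = 0 -> f w *m c = 0 -> f (v + w) *m c = 0.
Proof.
have [Z hZ] := f_hyperplane c => hv hw; apply/eqP; rewrite -hZ.
by rewrite addmx_sub // hZ ?hv ?hw.
Qed.

Lemma vanish_scale a (v : 'rV_n) (c : 'cV_n) :
  f v *m c = 0 -> f (a *: v) *m c = 0.
Proof.
have [Z hZ] := f_hyperplane c => hv; apply/eqP; rewrite -hZ.
by rewrite scalemx_sub // hZ hv.
Qed.

Lemma vanish_comb (I : finType) (P : pred I) (a : I -> F)
    (w : I -> 'rV[F]_n) (c : 'cV_n) :
  (forall i, P i -> f (w i) *m c = 0) ->
  f (\sum_(i | P i) a i *: w i) *m c = 0.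
Proof.
have [Z hZ] := f_hyperplane c => hw; apply/eqP; rewrite -hZ.
by apply: summx_sub => i Pi; rewrite scalemx_sub // hZ hw.
Qed.

Lemma f_basis_neq i k : k != i -> f (e k) 0 i = 0.
Proof.
have [a _ ->] := f_basis k => ki.
by rewrite !mxE eqxx eq_sym (negPf ki) mulr0.
Qed.

(** The [w] with [f w 0 i = 0] form a subspace that contains every [e k] with [k != i] but not
    [e i], which leaves only the coordinate hyperplane. *)
Lemma f_coord_eq0 (v : 'rV_n) i : (f v 0 i == 0) = (v 0 i == 0).
Proof.
have scalar0 (a : F) : (a%:M == 0 :> 'M_1) = (a == 0).
  by apply/eqP/eqP => [/matrixP/(_ 0 0)|->]; rewrite ?raddf0 // !mxE eqxx.
have [Z hZ'] := f_hyperplane (delta_mx i 0).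
have hZ (w : 'rV_n) : (w <= Z)%MS = (f w 0 i == 0).
  by rewrite hZ' mul_row_delta scalar0.
pose r : 'rV_n := \sum_(k | k != i) v 0 k *: e k.
have rZ : (r <= Z)%MS.
  by apply: summx_sub => k ki; rewrite scalemx_sub // hZ f_basis_neq.
have eiZ : (e i <= Z)%MS = false.
  by have [a a0 ea] := f_basis i; rewrite hZ ea !mxE !eqxx mulr1 (negPf a0).
have vE : v = v 0 i *: e i + r.
  by rewrite {1}[v]row_sum_delta (bigD1 i).
rewrite -hZ; have [vi0 | vi0] := eqVneq (v 0 i) 0.
  by rewrite vE vi0 scale0r add0r.
apply: contraFF eiZ => vZ.
rewrite -(eqmx_scale (e i) vi0) -[_ *: _](addrK r) -vE.
by rewrite addmx_sub // -scaleN1r scalemx_sub.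
Qed.

(* ratio i j describes the action of f on the line through e_i and e_j, in the
   affine coordinate x_j / x_i. *)
Definition ratio i j x := f (e i + x *: e j) 0 j / f (e i + x *: e j) 0 i.

Lemma ratioP (v : 'rV_n) i j : i != j -> v 0 i != 0 ->
  f v 0 j = ratio i j (v 0 j / v 0 i) * f v 0 i.
Proof.
move=> ij vi0; set x := v 0 j / v 0 i; rewrite /ratio.
set u := e i + x *: e j.
have ui : u 0 i = 1 by rewrite !mxE !eqxx (negPf ij) mulr0 addr0.
have uj : u 0 j = x by rewrite !mxE !eqxx eq_sym (negPf ij) add0r mulr1.
have fui0 : f u 0 i != 0 by rewrite f_coord_eq0 ui oner_neq0.
(* This functional kills [f u] and every [f (e k)] with [k] distinct from [i] and [j]; [v] is a
   combination of [u] and these [e k], so [c] kills [f v] too. *)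
pose c : 'cV_n := f u 0 i *: delta_mx j 0 - f u 0 j *: delta_mx i 0.
have cE (w : 'rV_n) : w *m c = (f u 0 i * w 0 j - f u 0 j * w 0 i)%:M.
  by rewrite mulmxBr -!scalemxAr !mul_row_delta !scale_scalar_mx -raddfB.
have : f v *m c = 0.
  have ->: v = v 0 i *: u + \sum_(k | (k != i) && (k != j)) v 0 k *: e k.
    rewrite {1}[v]row_sum_delta (bigD1 i) // (bigD1 j) 1?eq_sym //= addrA.
    by rewrite scalerDr scalerA mulrC divfK.
  apply: vanish_add.
    by apply: vanish_scale; rewrite cE mulrC subrr raddf0.
  apply: vanish_comb => k /andP[ki kj].
  by rewrite cE !f_basis_neq // !mulr0 subrr raddf0.
rewrite cE => /matrixP/(_ 0 0); rewrite !mxE eqxx mulr1n => /eqP.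
by rewrite subr_eq0 => /eqP h; rewrite mulrAC -h mulrC mulKf.
Qed.

Lemma ratio0 i j : i != j -> ratio i j 0 = 0.
Proof.
move=> ij; rewrite /ratio scale0r addr0 f_basis_neq ?mul0r //.
Qed.

Lemma ratio1 i j : i != j -> ratio i j 1 = 1.
Proof.
move=> ij; have [a a0 fa] := f_ones.
have := @ratioP (const_mx 1) i j ij.
rewrite fa !mxE divr1 oner_neq0 => /(_ isT).
by move=> h; apply: (mulIf a0); rewrite mul1r -h.
Qed.

(** In [e i + x *: e j + (x * y) *: e k], the ratio of coordinates [k] and [i] factors through
    coordinate [j]. Putting [y = 1] or [x = 1] later gives independence of target and source. *)
Lemma ratio_mul i j k x y : i != j -> j != k -> i != k ->
  ratio i k (x * y) = ratio j k y * ratio i j x.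
Proof.
move=> ij jk ik; have [-> | x0] := eqVneq x 0.
  by rewrite mul0r !ratio0 // mulr0.
pose v : 'rV_n := e i + x *: e j + (x * y) *: e k.
have vi : v 0 i = 1.
  by rewrite !mxE !eqxx (negPf ij) (negPf ik) !mulr0 !addr0.
have vj : v 0 j = x.
  by rewrite !mxE !eqxx eq_sym (negPf ij) (negPf jk) mulr0 addr0 mulr1 add0r.
have vk : v 0 k = x * y.
  rewrite !mxE !eqxx eq_sym (negPf ik) eq_sym (negPf jk).
  by rewrite mulr0 !add0r mulr1.
have vi0 : v 0 i != 0 by rewrite vi oner_neq0.
have fvi0 : f v 0 i != 0 by rewrite f_coord_eq0.
apply: (mulIf fvi0); have := ratioP ik vi0; rewrite vi vk divr1 => <-.
have xyx : x * y / x = y by rewrite mulrAC divff // mul1r.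
have vj0 : v 0 j != 0 by rewrite vj.
rewrite (ratioP jk) // vj vk xyx -[RHS]mulrA; congr (_ * _).
by rewrite (ratioP ij) // vi vj divr1.
Qed.

Lemma ratio_target i j k x : i != j -> i != k -> ratio i k x = ratio i j x.
Proof.
move=> ij ik; have [-> // | jk] := eqVneq j k.
by rewrite -[x in LHS]mulr1 (@ratio_mul i j) ?ratio1 ?mul1r.
Qed.

Lemma ratio_source i j k x : i != k -> j != k -> ratio i k x = ratio j k x.
Proof.
move=> ik jk; have [-> // | ij] := eqVneq i j.
by rewrite -[x in LHS]mul1r (@ratio_mul i j) ?ratio1 ?mulr1.
Qed.

(* The vector e_i + (x + y) e_j + e_k lies on the line through e_i + x e_j and
   e_k + y e_j. *)
Lemma ratio_add i j k x y : i != j -> j != k -> i != k ->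
  ratio i j (x + y) = ratio i j x + ratio k j y.
Proof.
move=> ij jk ik; have kj : k != j by rewrite eq_sym.
pose u := e i + x *: e j; pose w := e k + y *: e j; pose v := u + w.
pose E := (mxE, eqxx, negPf ij, negPf jk, negPf ik, negPf kj,
  eq_sym j i, eq_sym k i, mulr0, addr0, add0r, mulr1).
have [ui uk] : u 0 i = 1 /\ u 0 k = 0 by rewrite !E.
have uj : u 0 j = x by rewrite !E.
have [wi wk] : w 0 i = 0 /\ w 0 k = 1 by rewrite !E.
have wj : w 0 j = y by rewrite !E.
have vi : v 0 i = 1 by rewrite mxE ui wi addr0.
have vk : v 0 k = 1 by rewrite mxE uk wk add0r.
have vj : v 0 j = x + y by rewrite mxE uj wj.
have nz1 (a : 'rV[F]_n) l : a 0 l = 1 -> a 0 l != 0.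
  by move=> ->; rewrite oner_neq0.
(* A functional chosen to vanish on both [f u] and [f w], hence on [f v]. *)
pose c : 'cV_n := delta_mx j 0 - ratio i j x *: delta_mx i 0
  - ratio k j y *: delta_mx k 0.
have cE (z : 'rV_n) :
    z *m c = (z 0 j - ratio i j x * z 0 i - ratio k j y * z 0 k)%:M.
  by rewrite !mulmxBr -!scalemxAr !mul_row_delta !scale_scalar_mx -!raddfB.
have f0 (z : 'rV_n) l : z 0 l = 0 -> f z 0 l = 0.
  by move=> zl; apply/eqP; rewrite f_coord_eq0 zl.
have : f v *m c = 0.
  apply: vanish_add; rewrite cE.
    rewrite (f0 u k) // (ratioP ij (nz1 _ _ ui)) ui uj divr1 mulr0.
    by rewrite subrr subr0 raddf0.
  rewrite (f0 w i) // (ratioP kj (nz1 _ _ wk)) wk wj divr1 mulr0.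
  by rewrite subr0 subrr raddf0.
(* As [ratio i k 1 = 1], coordinates [i] and [k] of [f v] agree, and this common nonzero factor
   cancels. *)
rewrite cE (ratioP ij (nz1 _ _ vi)) (ratioP ik (nz1 _ _ vi)) vi vj vk !divr1.
rewrite ratio1 // mul1r -!mulrBl => /matrixP/(_ 0 0); rewrite !mxE eqxx mulr1n.
move/eqP; rewrite mulf_eq0 f_coord_eq0 vi oner_eq0 orbF -addrA -opprD subr_eq0.
by move/eqP.
Qed.

Hypothesis n_ge3 : (3 <= n)%N.

Lemma ratio_indep i j i' j' x : i != j -> i' != j' ->
  ratio i j x = ratio i' j' x.
Proof.
move=> ij ij'; have [eq_ij' | neq_ij'] := eqVneq i j'; last first.
  by rewrite (@ratio_target i j') // (@ratio_source i i').
(* When [i = j'] the intermediate pair [(i, j')] is degenerate; a third index allows the detour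
   [(i, k)], [(i', k)], [(i', j')]. *)
have [k ki ki'] : exists2 k : 'I_n, i != k & i' != k.
  have : (0 < #|~: [set i; i']|)%N.
    rewrite -(ltn_add2l #|[set i; i']|) cardsC card_ord cards2 addn0.
    by case: (i != i') => //; apply: ltnW.
  case/card_gt0P => k; rewrite !inE negb_or ![k == _]eq_sym => /andP[].
  by exists k.
rewrite (@ratio_target i k) // (@ratio_source i i') //.
by rewrite (@ratio_target i' j').
Qed.

Lemma frame_fixing_semilinear :
  exists2 U : {rmorphism F -> F}, bijective U &
    forall v, exists2 a, a != 0 & f v = a *: map_mx U v.
Proof.
have n_gt1 : (1 < n)%N by apply: ltnW.
pose i0 : 'I_n := Ordinal (ltnW n_gt1).
pose i1 : 'I_n := Ordinal n_gt1.
pose i2 : 'I_n := Ordinal n_ge3.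
have i01 : i0 != i1 by []. have i12 : i1 != i2 by []. have i02 : i0 != i2 by [].
pose u := ratio i0 i1.
have u_ratio i j x : i != j -> ratio i j x = u x.
  by move=> ij; apply: ratio_indep.
have u1 : u 1 = 1 by apply: ratio1.
have u0 : u 0 = 0 by apply: ratio0.
have uM x y : u (x * y) = u x * u y.
  by rewrite mulrC -(u_ratio i0 i2) // (ratio_mul _ _ i01) // !u_ratio // mulrC.
have uD x y : u (x + y) = u x + u y.
  by rewrite -(u_ratio i0 i1) // (ratio_add _ _ i01 i12) // !u_ratio // eq_sym.
have uN x : u (- x) = - u x.
  by apply/eqP; rewrite -addr_eq0 -uD addNr u0.
have u_zmod : zmod_morphism u by move=> x y; rewrite uD uN.
have u_monoid : monoid_morphism u by split.
pose addU := GRing.isZmodMorphism.Build F F u u_zmod.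
pose mulU := GRing.isMonoidMorphism.Build F F u u_monoid.
pose U : {rmorphism F -> F} := HB.pack u addU mulU.
exists U; first exact/injF_bij/fmorph_inj.
move=> v; have [-> | /rV0Pn[i vi]] := eqVneq v 0.
  exists 1; rewrite ?oner_neq0 // map_mx0 scaler0; apply/rowP => i.
  by rewrite mxE; apply/eqP; rewrite f_coord_eq0 mxE.
(* The scalar is forced by comparing both sides at a nonzero coordinate of [v]. *)
exists (f v 0 i / U (v 0 i)).
  by rewrite mulf_neq0 ?invr_eq0 ?fmorph_eq0 ?f_coord_eq0.
apply/rowP => j; rewrite !mxE; have [<- | ij] := eqVneq i j.
  by rewrite divfK ?fmorph_eq0.
have uV : u (v 0 j / v 0 i) = U (v 0 j) / U (v 0 i) := fmorph_div U _ _.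
by rewrite (ratioP ij vi) u_ratio // uV mulrC mulrA mulrAC.
Qed.

End FrameFixing.

(** * Left ideals as row spaces, and weak inclusion recovered from strict inclusion *)

Lemma left_ideal_subset (F : finFieldType) n (X Y : 'M[F]_n) :
  (left_ideal X \subset left_ideal Y) = (X <= Y)%MS.
Proof.
apply/subsetP/submxP => [sXY | [A ->] Z /imsetP[B _ ->]].
  have /sXY/imsetP[A _ XE] : X \in left_ideal X; last by exists A.
  by apply/imsetP; exists 1%:M; rewrite ?inE ?mul1mx.
by apply/imsetP; exists (B *m A); rewrite ?inE ?mulmxA.
Qed.

Lemma left_ideal_graphE (F : finFieldType) n (X Y : 'M[F]_n) :
  left_ideal_graph X Y = (X < Y)%MS.
Proof. by rewrite /left_ideal_graph properE !left_ideal_subset. Qed.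

(** If [X] has rank at least 2, each of its lines lies strictly below it, hence below [Y]. If [X]
    and [Y] were distinct lines, a hyperplane through [X] that misses [Y] would contradict the
    equality of strict superspaces. *)
Lemma submx_eq_neighbours (F : fieldType) n (X Y : 'M[F]_n) : (2 < n)%N ->
  (forall Z : 'M_n, (Z < X)%MS = (Z < Y)%MS) ->
  (forall Z : 'M_n, (X < Z)%MS = (Y < Z)%MS) ->
  (X <= Y)%MS.
Proof.
move=> n_gt2 below above.
have [rX | rX] := ltnP 1 (\rank X).
  apply/rV_subP => v vX; rewrite -genmxE ltmxW // -below ltmxErank !genmxE vX.
  by rewrite rank_rV (leq_ltn_trans (leq_b1 _)).
have [-> | X0] := eqVneq X 0; first exact: sub0mx.
have Y0 : Y != 0 by rewrite -lt0mx -below lt0mx.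
have rX1 : \rank X = 1%N by apply/eqP; rewrite eqn_leq rX lt0n mxrank_eq0.
apply: contraT => nXY.
have rXY : (1 < \rank (X + Y)%MS <= 2)%N.
  apply/andP; split.
    apply: (@leq_ltn_trans (\rank Y)); first by rewrite lt0n mxrank_eq0.
    by apply: rank_ltmx; rewrite ltmxE addsmxSr addsmx_sub (negPf nXY).
  rewrite (leq_trans (leq_of_leqif (mxrank_adds_leqif X Y))) // rX1 add1n ltnS.
  rewrite leqNgt; apply: contra Y0 => rY; apply/rowV0P => v vY.
  have : (<<v>> < Y)%MS.
    by rewrite ltmxErank !genmxE vY rank_rV (leq_ltn_trans (leq_b1 _)).
  by rewrite -below => /rank_ltmx; rewrite genmxE rX1 rank_rV; case: eqVneq.
have [rXY_gt1 rXY_le2] := andP rXY.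
(* The complement is nonzero because [n > 2], so [X < Z] and hence [Y <= Z]. Then [Z] is the full
   space, although its rank is at most [1 + (n - 2)]. *)
pose Z := (X + (X + Y)^C)%MS.
have XZ : (X < Z)%MS.
  rewrite ltmxE addsmxSl addsmx_sub submx_refl /=; apply/negP => sCX.
  have /eqP : \rank (X + Y)^C%MS = 0%N.
    apply/eqP; rewrite mxrank_eq0 -submx0 -(capmx_compl (X + Y)%MS) sub_capmx.
    by rewrite submx_refl (submx_trans sCX) // addsmxSl.
  by rewrite mxrank_compl subn_eq0 leqNgt (leq_ltn_trans rXY_le2).
have YZ : (Y <= Z)%MS by rewrite ltmxW // -above.
have : row_full Z.
  rewrite -sub1mx (submx_trans _ (_ : (X + Y) + (X + Y)^C <= Z)%MS) //.
    by rewrite sub1mx addsmx_compl_full.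
  by rewrite !addsmx_sub YZ addsmxSl addsmxSr.
rewrite /row_full => /eqP rZ.
have : (\rank Z <= \rank X + \rank (X + Y)^C%MS)%N
  := leq_of_leqif (mxrank_adds_leqif _ _).
rewrite rZ rX1 mxrank_compl leqNgt => /negP[].
by rewrite -ltn_subRL ltn_sub2l // (leq_ltn_trans _ n_gt2).
Qed.

(** The right-hand side mentions only strict inclusion, so it is invariant under graph
    automorphisms. *)
Lemma submx_neighbours (F : fieldType) n (X Y : 'M[F]_n) : (2 < n)%N ->
  (X <= Y)%MS <-> (X < Y)%MS \/ (forall Z : 'M_n,
    (Z < X)%MS = (Z < Y)%MS /\ (X < Z)%MS = (Y < Z)%MS).
Proof.
move=> n_gt2; split=> [sXY | [/ltmxW // | eqXY]]; last first.
  by apply: submx_eq_neighbours => // Z; have [] := eqXY Z.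
have [sYX | nYX] := boolP (Y <= X)%MS; last by left; rewrite ltmxE sXY.
have eqXY : (X :=: Y)%MS by apply/eqmxP; rewrite sXY.
by right=> Z; rewrite !ltmxE !eqXY.
Qed.

Lemma aut_submx (F : finFieldType) n (Psi : {perm 'M[F]_n}) : (2 < n)%N ->
  Psi \in digraph_aut (@left_ideal_graph F n) ->
  forall X Y : 'M_n, (Psi X <= Psi Y)%MS = (X <= Y)%MS.
Proof.
move=> n_gt2 /digraph_autP aut X Y.
have lt_Psi (A B : 'M_n) : (Psi A < Psi B)%MS = (A < B)%MS.
  by rewrite -!left_ideal_graphE aut.
apply/idP/idP => /(submx_neighbours _ _ n_gt2) sXY;
  apply/submx_neighbours => //.
  case: sXY => [| eqXY]; first by rewrite lt_Psi; left.
  by right=> Z; have := eqXY (Psi Z); rewrite !lt_Psi.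
case: sXY => [| eqXY]; first by left; rewrite lt_Psi.
by right=> Z; rewrite -[Z](permKV Psi) !lt_Psi.
Qed.

(** * The map on points induced by an inclusion-preserving bijection *)

Section PointImage.

Variables (F : finFieldType) (n : nat) (h : 'M[F]_n -> 'M[F]_n).

Hypothesis h_bij : bijective h.

Hypothesis h_submx : forall X Y : 'M_n, (h X <= h Y)%MS = (X <= Y)%MS.

(** [<<v>>] makes the row a square matrix to which [h] applies; [nz_row] picks a nonzero row of the
    result, if there is one. *)
Definition point_image (v : 'rV[F]_n) : 'rV[F]_n := nz_row (h <<v>>%MS).

Local Notation f := point_image.

Lemma h_surj (Y : 'M_n) : exists X, h X = Y.
Proof. by case: h_bij => g _ gK; exists (g Y). Qed.

(** The span of [f v] is some [h Z] with [Z <= v]. If [f v] is nonzero then so is [Z], and since [v]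
    has rank at most 1, [Z] is all of [<<v>>]. *)
Lemma point_imageE v : (f v :=: h <<v>>)%MS.
Proof.
apply/eqmxP; rewrite nz_row_sub /=.
have [Z hZ] := h_surj <<f v>>%MS.
have sZv : (Z <= v)%MS by rewrite -(genmxE v) -h_submx hZ genmxE nz_row_sub.
have [fv0 | fv_neq0] := eqVneq (f v) 0.
  by move/eqP: fv0; rewrite nz_row_eq0 => /eqP ->; rewrite sub0mx.
rewrite -(genmxE (f v)) -hZ h_submx genmxE.
have Z0 : Z != 0.
  apply: contraNneq fv_neq0 => Z0; have [W hW] := h_surj 0.
  have := h_submx 0 W; rewrite sub0mx -Z0 hZ hW genmxE => fv0.
  by rewrite -submx0 fv0.
rewrite -(mxrank_leqif_sup sZv) eqn_leq mxrankS //=.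
by rewrite (leq_trans (rank_leq_row v)) // lt0n mxrank_eq0.
Qed.

Lemma point_image_sub v (X : 'M_n) : (f v <= h X)%MS = (v <= X)%MS.
Proof. by rewrite point_imageE h_submx genmxE. Qed.

Lemma point_image_hyperplane (c : 'cV[F]_n) :
  exists Z : 'M[F]_n, forall w : 'rV_n, (w <= Z)%MS = (f w *m c == 0).
Proof.
have [Z hZ] := h_surj (kermx c); exists Z => w.
by rewrite -point_image_sub hZ; apply/sub_kermxP/eqP.
Qed.

Definition frame_mx : 'M[F]_n := \matrix_i f (delta_mx 0 i).

(** The preimage of the span of all [f (e_i)] contains every [e_i], so it is the full space and lies
    above the preimage of the identity. *)
Lemma frame_mx_unit : frame_mx \in unitmx.
Proof.
rewrite -row_full_unit -sub1mx; have [Z hZ] := h_surj frame_mx.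
have [W hW] := h_surj 1%:M.
rewrite -hZ -hW h_submx (submx_trans (submx1 _)) //.
apply/row_subP => i; rewrite row1 -point_image_sub hZ.
by rewrite -[f _](rowK (fun i => f (delta_mx 0 i))) row_sub.
Qed.

Lemma point_image_semilinear : (2 < n)%N ->
  exists (U : {rmorphism F -> F}) (B : 'M[F]_n),
  [/\ bijective U, B \in unitmx &
      forall v, (f v :=: map_mx U v *m B)%MS].
Proof.
move=> n_gt2; pose A := frame_mx; have uA := frame_mx_unit.
(* [r] holds the coordinates of the image of the all-ones vector in the basis formed by the rows of
   [A]. *)
have [r rE] : exists r, r = f (const_mx 1) *m invmx A by eexists.
have fA k : f (delta_mx 0 k) *m invmx A = delta_mx 0 k.
  have ->: f (delta_mx 0 k) = delta_mx 0 k *m A by rewrite -rowE rowK.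
  by rewrite mulmxK.
(* If [r 0 i = 0], one subspace contains the all-ones vector and every [e_k] with [k != i], hence
   also [e_i], whose image has coordinate 1 there. *)
have r0 i : r 0 i != 0.
  apply/eqP => ri0.
  have [Z hZ] := point_image_hyperplane (invmx A *m delta_mx i 0).
  have kZ k : k != i -> ((delta_mx 0 k : 'rV_n) <= Z)%MS.
    by move=> ki; rewrite hZ mulmxA fA mul_delta_mx_0.
  have oneZ : ((const_mx 1 : 'rV_n) <= Z)%MS.
    by rewrite hZ mulmxA -rE mul_row_delta ri0 raddf0.
  have oneE : const_mx 1 =
      delta_mx 0 i + \sum_(k | k != i) delta_mx 0 k :> 'rV[F]_n.
    rewrite [LHS]row_sum_delta (bigD1 i) //= mxE scale1r; congr (_ + _).
    by apply: eq_bigr => k _; rewrite mxE scale1r.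
  have : ((delta_mx 0 i : 'rV_n) <= Z)%MS.
    rewrite -[delta_mx 0 i](addrK (\sum_(k | k != i) delta_mx 0 k)) -oneE.
    by rewrite addmx_sub // -scaleN1r scalemx_sub //; exact: summx_sub.
  rewrite hZ mulmxA fA mul_delta_mx => /eqP/matrixP/(_ 0 0)/eqP.
  by rewrite !mxE eqxx oner_eq0.
(* In the basis of the rows of B, the image of the all-ones vector is again
   all-ones. *)
pose B := diag_mx r *m A.
have uD : diag_mx r \in unitmx.
  rewrite unitmxE det_diag unitfE; apply/prodf_neq0 => i _; exact: r0.
have uB : B \in unitmx by rewrite unitmx_mul uD.
have invB w : w *m invmx B = w *m invmx A *m invmx (diag_mx r) :> 'rV_n.
  by apply: (canLR (mulmxK uB)); rewrite /B mulmxA mulmxKV // mulmxKV.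
have invD (w w' : 'rV_n) : w' *m diag_mx r = w -> w *m invmx (diag_mx r) = w'.
  by move=> <-; rewrite mulmxK.
have [|i||//|U U_bij fU] :=
    @frame_fixing_semilinear F n (fun v => f v *m invmx B).
- move=> c; have [Z hZ] := point_image_hyperplane (invmx B *m c).
  by exists Z => w; rewrite hZ mulmxA.
- exists (r 0 i)^-1; rewrite ?invr_eq0 // invB fA; apply: invD.
  apply/rowP => j; rewrite -scalemxAl mul_mx_diag !mxE eqxx /=.
  by have [-> | _] := eqVneq j i; rewrite ?mul1r ?mulVf ?mul0r ?mulr0.
- exists 1; rewrite ?oner_neq0 // invB -rE; apply: invD.
  by apply/rowP => j; rewrite mul_mx_diag !mxE mul1r.
exists U, B; split=> // v; have [a a0 fv] := fU v.
have -> : f v = a *: (map_mx U v *m B) by rewrite scalemxAl -fv mulmxKV.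
exact: eqmx_scale.
Qed.

End PointImage.

(** * From points to all subspaces, and the factorisation of [Psi] *)

Lemma submx_preserving_semilinear (F : finFieldType) n
    (h : 'M[F]_n -> 'M[F]_n) :
    (2 < n)%N -> bijective h ->
    (forall X Y : 'M_n, (h X <= h Y)%MS = (X <= Y)%MS) ->
  exists (U : {rmorphism F -> F}) (B : 'M[F]_n),
  [/\ bijective U, B \in unitmx &
      forall X, (h X :=: map_mx U X *m B)%MS].
Proof.
move=> n_gt2 h_bij h_submx.
have [U [B [U_bij uB fE]]] := point_image_semilinear h_bij h_submx n_gt2.
exists U, B; split=> // X; have [V UK VK] := U_bij.
have sub_hX (v : 'rV_n) : (map_mx U v *m B <= h X)%MS = (v <= X)%MS.
  by rewrite -fE (point_image_sub h_bij).
apply/eqmxP/andP; split; last first.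
  by apply/row_subP => i; rewrite row_mul -map_row sub_hX row_sub.
(* Since [U] and [B] are invertible, every vector [w] is the semilinear image of some [v], for which
   [sub_hX] decides membership. *)
apply/rV_subP => w whX; pose v := map_mx V (w *m invmx B).
have wE : w = map_mx U v *m B.
  by rewrite -map_mx_comp (map_mx_id VK) mulmxKV.
by rewrite wE submxMr // map_submx -sub_hX -wE.
Qed.

Theorem theorem3p27 (F : finFieldType) (n : nat) (hn : (3 <= n)%N)
    (Psi : {perm 'M[F]_n})
    (hPsi : Psi \in digraph_aut (@left_ideal_graph F n)) :
  exists (P : 'M[F]_n) (Upsilon : {rmorphism F -> F})
         (sigma : {perm 'M[F]_n}),
    [/\ P \in unitmx,
        bijective Upsilon,
        forall X : 'M[F]_n, left_ideal (sigma X) = left_ideal X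
      & Psi =1 phi P \o map_mx Upsilon \o sigma].
Proof.
have Psi_bij : bijective Psi.
  by exists (Psi^-1)%g; [exact: permK | exact: permKV].
have [U [P [U_bij uP PsiE]]] :=
  submx_preserving_semilinear hn Psi_bij (aut_submx hn hPsi).
have [V UK VK] := U_bij.
pose s (X : 'M_n) := map_mx V (Psi X *m invmx P).
have UsE X : map_mx U (s X) *m P = Psi X.
  by rewrite -map_mx_comp (map_mx_id VK) mulmxKV.
have s_inj : injective s.
  by move=> X Y eqs; apply: (@perm_inj _ Psi); rewrite -!UsE eqs.
exists P, U, (perm s_inj); split=> // X; last by rewrite /= permE /phi UsE.
(* [Psi X] has the row space of [map_mx U X *m P] and equals [map_mx U (s X) *m P]; cancelling [P]
   and then [U] compares [s X] with [X]. *)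
have eqX : (s X :=: X)%MS.
  apply/(map_eqmx U)/eqmxP; have /eqmxP := PsiE X.
  by rewrite -UsE !submxMfree ?row_free_unit.
by apply/eqP; rewrite permE eqEsubset !left_ideal_subset !eqX submx_refl.
Qed.
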